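(* Let $f$ be a decomposable uniform CN function with CN form $f=[g:g_1,\dots,g_r]$ and decomposition $((\bm x_1,\bm y_1),\dots,(\bm x_p,\bm y_p))$ of $(\bm x,\bm y)$, and let $(\bm x^*,\bm y^* )\in X(f)$. For each $j=1,\dots,p$ define $$K_{uj}(\bm x_j^*,\bm y_j^* )=\Big\{(\bm x_j,\bm y_j)\in\mathbb{R}^{p_j}\times\mathbb{R}^{q_j}:\ \nabla_jg(\bm x^*,\bm y^* )^\top(\bm x_j-\bm x_j^*,\bm y_j-\bm y_j^* )+\tfrac{\bar\rho}{2}\|(\bm x_j-\bm x_j^*,\bm y_j-\bm y_j^* )\|^2<0\Big\}.$$ If $X(\bm g_j)\cap K_{uj}(\bm x_j^*,\bm y_j^* )=\emptyset$ holds for each $j=1,\dots,p$, then $(\bm x^*,\bm y^* )$ is an optimal solution to (CNP) and $\bm x^*$ is an optimal solution to (CNO).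
   Context: Let $f:\mathbb{R}^n\to\mathbb{R}$ be nonconvex and let $g,g_1,\dots,g_r:\mathbb{R}^n\times\mathbb{R}^m\to\mathbb{R}$ ($r\ge1$) be convex and twice differentiable. Put $X(\bm g)=\{(\bm x,\bm y): g_i(\bm x,\bm y)=0,\ i=1,\dots,r\}$. $f$ is a CN (convertible nonconvex) function with CN form $f=[g:g_1,\dots,g_r]$ if for each $\bm x\in\mathbb{R}^n$ there is $\bm y\in\mathbb{R}^m$ with $(\bm x,\bm y)\in X(\bm g)$ and $f(\bm x)=g(\bm x,\bm y)=\min_{(\bm x,\bm y')\in X(\bm g)}g(\bm x,\bm y')$. It is a uniform CN function if moreover $g$ is uniform convex: there is $\bar\rho>0$ (fixed) with $g((\bm x,\bm y)+\bm d)-g(\bm x,\bm y)\ge\nabla g(\bm x,\bm y)^\top\bm d+\frac{\bar\rho}{2}\|\bm d\|^2$ for all $(\bm x,\bm y),\bm d\in\mathbb{R}^n\times\mathbb{R}^m$. $X(f)=\{(\bm x,\bm y)\in X(\bm g): f(\bm x)=g(\bm x,\bm y)\}$. (CNO): $\min f(\bm x)$ s.t. $\bm x\in\mathbb{R}^n$. (CNP): $\min g(\bm x,\bm y)$ s.t. $g_i(\bm x,\bm y)=0$, $i=1,\dots,r$. ''Optimal solution'' means global minimizer. Decomposition: the variables of $(\bm x,\bm y)\in\mathbb{R}^n\times\mathbb{R}^m$ are rearranged into $p$ blocks ($2\le p\le\min\{n,m\}$) $((\bm x_1,\bm y_1),\dots,(\bm x_p,\bm y_p))$, $\bm x_j\in\mathbb{R}^{p_j}$,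 $\bm y_j\in\mathbb{R}^{q_j}$, $\sum_jp_j=n$, $\sum_jq_j=m$, with no variable common to two blocks. $f$ is decomposable if each of $g_1,\dots,g_r$ depends on the variables of one block only, so that the constraints can be written $\bm g(\bm x,\bm y)=(\bm g_1(\bm x_1,\bm y_1),\dots,\bm g_p(\bm x_p,\bm y_p))=0$. $\nabla_j$ denotes the gradient with respect to the block $(\bm x_j,\bm y_j)$, the other blocks being fixed. $X(\bm g_j)$ is the set of $(\bm x_j,\bm y_j)\in\mathbb{R}^{p_j}\times\mathbb{R}^{q_j}$ for which all constraints $g_i=0$ hold when the other blocks are fixed at the values of a point of $X(\bm g)$; in the decomposable case this is $\{(\bm x_j,\bm y_j):\bm g_j(\bm x_j,\bm y_j)=0\}$. *)

(* Defs.v *)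
From HB Require Import structures.
From mathcomp Require Export all_boot all_order all_algebra.
From mathcomp Require Export all_classical all_reals all_analysis.
Export Order.TTheory GRing.Theory Num.Theory numFieldNormedType.Exports.

Set Implicit Arguments.
Unset Strict Implicit.
Unset Printing Implicit Defensive.

Local Open Scope classical_set_scope.
Local Open Scope ring_scope.

(* R^n x R^m with the library's product topology. The library norm on 'rV and
   on products is the sup norm: it is used only for differentiability, where
   all norms are equivalent. Euclidean quantities go through dot and sqnorm. *)
Notation vpair R n m := ('rV[R]_n * 'rV[R]_m)%type.

Section Calculus.
Context {R : realType} {n m : nat}.
Implicit Types (z u v d : vpair R n m) (h : vpair R n m -> R).

Definition dot u v : R :=
  \sum_(k < n) u.1 0 k * v.1 0 k + \sum_(l < m) u.2 0 l * v.2 0 l.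

Definition sqnorm u : R := dot u u.

Definition grad h z : vpair R n m :=
  (\row_(k < n) 'D_((delta_mx 0 k, 0) : vpair R n m) (h : _ -> R^o) z,
   \row_(l < m) 'D_((0, delta_mx 0 l) : vpair R n m) (h : _ -> R^o) z).

Definition twice_differentiable h : Prop :=
  (forall z, differentiable (h : _ -> R^o) z) /\
  (forall z, differentiable (grad h) z).

Definition uniform_convex (rho : R) h : Prop :=
  0 < rho /\
  forall z d, h (z + d) - h z >= dot (grad h z) d + rho / 2 * sqnorm d.

End Calculus.

Definition convex {R : realType} {E : lmodType R} (h : E -> R) : Prop :=
  @convex_function R E setT h.

Definition minimizer {R : realType} {T : Type} (S : set T) (h : T -> R) (t : T)
  : Prop := S t /\ forall s, S s -> h t <= h s.

Section ConvertibleNonconvex.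
Context {R : realType} {n m r : nat}.
Implicit Types (f : 'rV[R]_n -> R) (g : vpair R n m -> R)
  (gs : 'I_r -> vpair R n m -> R).

Definition Xg gs : set (vpair R n m) := [set z | forall i, gs i z = 0].

Definition CN f g gs : Prop :=
  [/\ (0 < r)%N,
      ~ convex f,
      convex g /\ twice_differentiable g,
      forall i, convex (gs i) /\ twice_differentiable (gs i)
    & forall x, exists y,
        minimizer [set y' | Xg gs (x, y')] (fun y' => g (x, y')) y /\
        f x = g (x, y)].

Definition uniform_CN (rho : R) f g gs : Prop :=
  CN f g gs /\ uniform_convex rho g.

Definition Xf f g gs : set (vpair R n m) :=
  [set z | Xg gs z /\ f z.1 = g z].

Definition CNO_optimal f (x : 'rV[R]_n) : Prop := minimizer setT f x.

Definition CNP_optimal g gs (z : vpair R n m) : Prop := minimizer (Xg gs) g z.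

End ConvertibleNonconvex.

(* A decomposition into p blocks sends each of the n variables x and of the m
   variables y to the index of the block it belongs to. *)
Notation decomposition n m p := (('I_n -> 'I_p) * ('I_m -> 'I_p))%type.

Definition vars {k p : nat} (c : 'I_k -> 'I_p) (j : 'I_p) : {set 'I_k} :=
  [set i | c i == j]%SET.

(* R^(p_j) x R^(q_j), for the block j of the decomposition b *)
Notation bpair R b j := (vpair R #|vars b.1 j| #|vars b.2 j|).

(* x with its coordinates in vars c j overwritten by w *)
Definition overwrite {R : realType} {k p : nat} (c : 'I_k -> 'I_p) (j : 'I_p)
    (w : 'rV[R]_#|vars c j|) (x : 'rV[R]_k) : 'rV[R]_k :=
  \row_i (if [pick l : 'I_#|vars c j| | enum_val l == i] is Some l
          then w 0 l else x 0 i).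

Section Decomposition.
Context {R : realType} {n m p : nat} (b : decomposition n m p).
Implicit Types (j : 'I_p) (z : vpair R n m).

(* the block (x_j, y_j) of (x, y), variables kept in increasing order *)
Definition block j z : bpair R b j :=
  (colsub enum_val z.1, colsub enum_val z.2).

Definition set_block j z (w : bpair R b j)
  : vpair R n m := (overwrite w.1 z.1, overwrite w.2 z.2).

Definition grad_block j (h : vpair R n m -> R) z :=
  grad (fun w => h (set_block z w)) (block j z).

Definition depends_only_on j (h : vpair R n m -> R) : Prop :=
  forall z z', block j z = block j z' -> h z = h z'.

Definition decomposable {r : nat} (gs : 'I_r -> vpair R n m -> R) : Prop :=
  forall i, exists j, depends_only_on j (gs i).

(* X(g_j), the other blocks being fixed at those of z, a point of X(g);
   Xblock_decomposable shows that z is immaterial in the decomposable case. *)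
Definition Xblock {r : nat} (gs : 'I_r -> vpair R n m -> R) z j
  : set (bpair R b j) :=
  [set w | Xg gs (set_block z w)].

Definition Ku (rho : R) (g : vpair R n m -> R) z j
  : set (bpair R b j) :=
  [set w | dot (grad_block j g z) (w - block j z)
           + rho / 2 * sqnorm (w - block j z) < 0].

End Decomposition.

Arguments Xblock {R n m p} b {r} gs z j.
Arguments Ku {R n m p} b rho g z j.

Lemma colsub_overwrite {R : realType} {k p : nat} (c : 'I_k -> 'I_p) (j : 'I_p)
    (w : 'rV[R]_#|vars c j|) (x : 'rV[R]_k) :
  colsub enum_val (overwrite w x) = w.
Proof.
apply/rowP => l; rewrite !mxE; case: pickP => [l' /eqP/enum_val_inj -> //|].
by move=> /(_ l); rewrite eqxx.
Qed.

Lemma colsub_overwrite_neq {R : realType} {k p : nat} (c : 'I_k -> 'I_p)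
    (j j' : 'I_p) (w : 'rV[R]_#|vars c j|) (x : 'rV[R]_k) : j' != j ->
  colsub (enum_val : 'I_#|vars c j'| -> _) (overwrite w x) =
  colsub enum_val x.
Proof.
move=> jj'; apply/rowP => l; rewrite !mxE; case: pickP => // l' /eqP e.
have := enum_valP l'; have := enum_valP l; rewrite !inE e => /eqP -> e'.
by rewrite e' in jj'.
Qed.

Lemma Xblock_decomposable {R : realType} {n m p r : nat}
    (b : decomposition n m p) (gs : 'I_r -> vpair R n m -> R) (z : vpair R n m)
    (j : 'I_p) (w : bpair R b j) :
  decomposable b gs -> Xg gs z ->
  Xblock b gs z j w <->
  (forall i, depends_only_on b j (gs i) ->
     forall z', block b j z' = w -> gs i z' = 0).
Proof.
have blk z' : block b j (set_block z' w) = w.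
  by case: w => w1 w2; rewrite /block !colsub_overwrite.
move=> dec Xz; split=> [Xw i di z' z'w|H i].
  by rewrite -(Xw i); apply: di; rewrite blk.
have [j' dj'] := dec i; have [e|ne] := eqVneq j' j.
  by rewrite e in dj'; apply: (H i dj'); rewrite blk.
by rewrite -(Xz i); apply: dj'; rewrite /block !colsub_overwrite_neq.
Qed.

(* Main.v *)
Require Import Defs.

Set Implicit Arguments.
Unset Strict Implicit.
Unset Printing Implicit Defensive.

Local Open Scope classical_set_scope.
Local Open Scope ring_scope.

(** Uniform convexity bounds [g z - g z*] below by the quadratic model
    [dot (grad g z* ) d + rho / 2 * sqnorm d] with [d = z - z*]. This model is
    separable: the inner product is the sum of the inner products of the blocks
    ([dot_sum_block]), and the gradient with respect to a block is the block of
    the gradient ([grad_block_grad]), so the model is the sum over [j] of the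
    functions whose negativity defines [Ku] at [j]. Since each constraint sees
    one block only, a feasible [z] may be transplanted into [z*] one block at a
    time without losing feasibility ([block_Xblock]); hence every block of [z]
    lies in [Xblock], so outside [Ku], and each summand of the model is
    nonnegative. This gives global optimality of [z*] for [g] on the feasible
    set. It passes to [f] because every [f x] is a value of [g] at a feasible
    point above [x]. *)

Section Blocks.
Context {R : realType}.

Lemma overwrite_colsub {k p : nat} (c : 'I_k -> 'I_p) (j : 'I_p) (t : R)
    (v : 'rV[R]_#|vars c j|) (x : 'rV[R]_k) :
  overwrite (t *: v + colsub enum_val x) x = t *: overwrite v 0 + x.
Proof.
apply/rowP => i; rewrite !mxE; case: pickP => [l /eqP <-|_]; rewrite ?mxE //.
by rewrite mulr0 add0r.
Qed.

Lemma overwrite_delta {k p : nat} (c : 'I_k -> 'I_p) (j : 'I_p)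
    (l : 'I_#|vars c j|) :
  overwrite (delta_mx 0 l) 0 = delta_mx 0 (enum_val l) :> 'rV[R]_k.
Proof.
apply/rowP => i; rewrite !mxE; case: pickP => [l' /eqP <-|noi]; rewrite ?mxE.
  by rewrite (inj_eq enum_val_inj).
by rewrite [i == _]eq_sym noi andbF.
Qed.

Lemma overwrite0 {k p : nat} (c : 'I_k -> 'I_p) (j : 'I_p) :
  overwrite (0 : 'rV[R]_#|vars c j|) 0 = 0 :> 'rV[R]_k.
Proof. by apply/rowP => i; rewrite !mxE; case: pickP => *; rewrite ?mxE. Qed.

Lemma sum_vars {k p : nat} (c : 'I_k -> 'I_p) (F : 'I_k -> R) :
  \sum_(j < p) \sum_(l < #|vars c j|) F (enum_val l) = \sum_(i < k) F i.
Proof.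
rewrite [RHS](partition_big c xpredT) //=; apply: eq_bigr => j _.
by rewrite -big_enum_val; apply: eq_bigl => i; rewrite inE.
Qed.

Context {n m p : nat} (b : decomposition n m p).
Implicit Types (z u v : vpair R n m) (j : 'I_p).

Lemma dot_sum_block u v :
  \sum_(j < p) dot (block b j u) (block b j v) = dot u v.
Proof.
rewrite big_split /=; congr (_ + _).
  rewrite -(sum_vars b.1); apply: eq_bigr => j _.
  by apply: eq_bigr => l _; rewrite !mxE.
rewrite -(sum_vars b.2); apply: eq_bigr => j _.
by apply: eq_bigr => l _; rewrite !mxE.
Qed.

Lemma blockB j u v : block b j (u - v) = block b j u - block b j v.
Proof. by congr (_, _); apply/rowP => l; rewrite ?mxE. Qed.

Lemma set_blockD j (t : R) (d : bpair R b j) z :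
  set_block z (t *: d + block b j z) = t *: set_block 0 d + z.
Proof. by congr (_, _); apply: (overwrite_colsub t). Qed.

(** The two difference quotients are the same function of the step, so the
    equality holds even where the derivatives do not exist. *)
Lemma derive_set_block j (h : vpair R n m -> R^o) z (d : bpair R b j) :
  'D_d (fun w => h (set_block z w) : R^o) (block b j z) =
  'D_(set_block 0 d) h z.
Proof.
rewrite /derive; set F := (F in F @ _); set G := (F in _ = lim (F @ _)).
suff -> : F = G by [].
apply/funext => t; rewrite /F /G /= set_blockD; congr (_ *: (_ - h _)).
by have := set_blockD 0 d z; rewrite !scale0r !add0r.
Qed.

Lemma grad_block_grad j (h : vpair R n m -> R) z :
  grad_block b j h z = block b j (grad h z).
Proof.
by congr (_, _); apply/rowP => l;
  rewrite !mxE derive_set_block /set_block /= overwrite_delta overwrite0.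
Qed.

Lemma block_set_block j (w : bpair R b j) z : block b j (set_block z w) = w.
Proof. by case: w => w1 w2; rewrite /block !colsub_overwrite. Qed.

Lemma block_set_block_neq j j' (w : bpair R b j) z :
  j' != j -> block b j' (set_block z w) = block b j' z.
Proof. by move=> ne; rewrite /block !colsub_overwrite_neq. Qed.

(** A constraint that depends on block [j] takes its value at [z] on the
    mixed point, and any other constraint takes its value at [z0]. *)
Lemma block_Xblock {r : nat} (gs : 'I_r -> vpair R n m -> R) z0 z j :
  decomposable b gs -> Xg gs z0 -> Xg gs z -> Xblock b gs z0 j (block b j z).
Proof.
move=> dec X0 Xz i; have [j' dj'] := dec i.
have [e|ne] := eqVneq j' j.
  by rewrite -(Xz i); apply: dj'; rewrite e block_set_block.
by rewrite -(X0 i); apply: dj'; rewrite block_set_block_neq.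
Qed.

Lemma model_sum_block (rho : R) (h : vpair R n m -> R) z0 z :
  \sum_(j < p) (dot (grad_block b j h z0) (block b j z - block b j z0)
    + rho / 2 * sqnorm (block b j z - block b j z0)) =
  dot (grad h z0) (z - z0) + rho / 2 * sqnorm (z - z0).
Proof.
rewrite /sqnorm -!dot_sum_block mulr_sumr -big_split /=.
by apply: eq_bigr => j _; rewrite grad_block_grad blockB.
Qed.

End Blocks.

(** The values of [f] are attained by [g] on the feasible set, so a minimizer
    of [g] at which [g] agrees with [f] projects to a minimizer of [f]. *)
Lemma CNP_CNO_optimal {R : realType} {n m r : nat} (f : 'rV[R]_n -> R)
    (g : vpair R n m -> R) (gs : 'I_r -> vpair R n m -> R) z :
  CN f g gs -> Xf f g gs z -> CNP_optimal g gs z -> CNO_optimal f z.1.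
Proof.
move=> [_ _ _ _ lift] [_ fz] [_ zmin]; split=> // x _.
by have [y [[Xy _] ->]] := lift x; rewrite fz; apply: zmin.
Qed.

Theorem theorem4p3 (R : realType) (n m r p : nat)
    (f : 'rV[R]_n -> R) (g : vpair R n m -> R) (gs : 'I_r -> vpair R n m -> R)
    (rho : R) (b : decomposition n m p) (xs : 'rV[R]_n) (ys : 'rV[R]_m)
    (hp : (2 <= p <= minn n m)%N)
    (hf : uniform_CN rho f g gs)
    (hdec : decomposable b gs)
    (hxy : Xf f g gs (xs, ys))
    (hK : forall j : 'I_p,
       Xblock b gs (xs, ys) j `&` Ku b rho g (xs, ys) j = set0) :
  CNP_optimal g gs (xs, ys) /\ CNO_optimal f xs.
Proof.
have [hCN [_ unif]] := hf; have [Xs _] := hxy.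
suff opt : CNP_optimal g gs (xs, ys) by split=> //; apply: CNP_CNO_optimal opt.
split=> // z Xz.
have := unif (xs, ys) (z - (xs, ys)); rewrite subrKC => gz.
rewrite -subr_ge0; apply: le_trans gz; rewrite -(model_sum_block b).
apply: sumr_ge0 => j _; rewrite leNgt; apply/negP => Kz.
have : (Xblock b gs (xs, ys) j `&` Ku b rho g (xs, ys) j) (block b j z).
  by split=> //; apply: block_Xblock.
by rewrite hK.
Qed.
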